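(* Let $(M^n,g,V)$ be a compact static manifold with boundary with non-positive cosmological constant, and suppose that $\partial M$ has exactly one connected component. Then either $\Sigma:=V^{-1}(0)$ intersects $\partial M$, or $V$ does not vanish in $M$.
   Context: All manifolds are orientable and connected. A static manifold with boundary is a triple $(M^n,g,V)$, where $(M^n,g)$ is an $n$-dimensional Riemannian manifold with boundary $\partial M$ and $V\colon M\to\mathbb R$ is a smooth function, not identically zero, satisfying $$\mathrm{Hess}_gV-(\Delta_gV)g-V\,\mathrm{Ric}_g=0\ \text{ in }M,\qquad \frac{\partial V}{\partial\nu}g-VB_g=0\ \text{ on }\partial M .$$ Here $\Delta_g=\mathrm{trace}_g\mathrm{Hess}_g$, $\nu$ is the outward unit normal to $\partial M$ and $B_g$ is the second fundamental form of $\partial M$ with respect to $\nu$ (sign convention: $B_g=g$ for the boundary of the Euclidean unit ball). It is known that the scalar curvature $R_g$ is constant; the cosmological constant $\Lambda$ is defined by $R_g=(n-1)\Lambda$. *)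

(* Defs.v *)
From HB Require Import structures.
From mathcomp Require Import all_boot all_order all_algebra.
From mathcomp Require Import all_classical all_reals all_analysis.
Set Implicit Arguments.
Unset Strict Implicit.
Unset Printing Implicit Defensive.
Import Order.TTheory GRing.Theory Num.Theory.
Import numFieldNormedType.Exports.
Local Open Scope classical_set_scope.
Local Open Scope ring_scope.

(* Manifolds have dimension d.+1; the coordinate of index ord0 is the one
   which is nonnegative on the model half-space. *)

Section LocalCalculus.
Context {R : realType} {d : nat}.
Local Notation E := 'rV[R]_d.+1.

Definition evec (i : 'I_d.+1) : E := delta_mx ord0 i.

Definition half_space : set E := [set x | 0 <= x ord0 ord0].

Fixpoint Ck (k : nat) (U : set E) (f : E -> R) : Prop :=
  (forall x, U x -> {for x, continuous f}) /\
  if k is k'.+1 then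
    forall i, (forall x, U x -> derivable f x (evec i)) /\
              Ck k' U (fun x => 'D_(evec i) f x)
  else True.

(* Smoothness on an arbitrary set: local extendability to a C^oo function on
   an open subset of R^(d.+1). *)
Definition smooth_on (A : set E) (f : E -> R) : Prop :=
  forall x, A x -> exists U F,
    [/\ open U, U x, (forall k, Ck k U F) & forall y, U y -> A y -> f y = F y].

(* i-th partial derivative along the half-space: the usual one in the interior,
   and one-sided in the direction i = ord0 at boundary points. *)
Definition partial (i : 'I_d.+1) (f : E -> R) (x : E) : R :=
  lim ((h^-1 * (f (x + h *: evec i) - f x))
        @[h --> within [set h : R | half_space (x + h *: evec i)] 0^']).

(* Row i of the Jacobian is the i-th partial derivative, so that row vectors
   of components of tangent vectors are transported by v |-> v *m jac f x. *)
Definition jac (f : E -> E) (x : E) : 'M[R]_d.+1 :=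
  \matrix_(i, j) partial i (fun y => f y ord0 j) x.

Section LocalGeometry.
Variable g : E -> 'M[R]_d.+1.

Definition ginv (x : E) : 'M[R]_d.+1 := invmx (g x).

(* Christoffel symbol Gamma^k_{ij} *)
Definition christoffel (k i j : 'I_d.+1) (x : E) : R :=
  2^-1 * \sum_l ginv x k l *
    (partial i (fun y => g y j l) x + partial j (fun y => g y i l) x
     - partial l (fun y => g y i j) x).

(* Component l of R(e_i, e_j) e_k, where
   R(X, Y) Z = nabla_X nabla_Y Z - nabla_Y nabla_X Z - nabla_[X, Y] Z *)
Definition riemann (l i j k : 'I_d.+1) (x : E) : R :=
  partial i (christoffel l j k) x - partial j (christoffel l i k) x
  + \sum_p (christoffel l i p x * christoffel p j k x
            - christoffel l j p x * christoffel p i k x).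

(* Ric(Y, Z) is the trace of X |-> R(X, Y) Z. *)
Definition ricci (x : E) : 'M[R]_d.+1 :=
  \matrix_(j, k) \sum_i riemann i i j k x.

Definition trace_g (x : E) (T : 'M[R]_d.+1) : R :=
  \sum_i \sum_j ginv x i j * T i j.

Definition scalar (x : E) : R := trace_g x (ricci x).

Definition hess (f : E -> R) (x : E) : 'M[R]_d.+1 :=
  \matrix_(i, j) (partial i (partial j f) x
                  - \sum_k christoffel k i j x * partial k f x).

Definition laplacian (f : E -> R) (x : E) : R := trace_g x (hess f x).

(* - grad x^0 / |grad x^0|, which on {x^0 = 0} is the outward unit normal *)
Definition normal (l : 'I_d.+1) (x : E) : R :=
  - ginv x l ord0 / Num.sqrt (ginv x ord0 ord0).

Definition normal_derivative (f : E -> R) (x : E) : R :=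
  \sum_l normal l x * partial l f x.

(* B(X, Y) = g(nabla_X normal, Y); only used on vectors tangent to {x^0 = 0}. *)
Definition second_ff (x : E) : 'M[R]_d.+1 :=
  \matrix_(i, j) \sum_l
    (partial i (normal l) x + \sum_k christoffel l i k x * normal k x)
    * g x l j.

End LocalGeometry.
End LocalCalculus.

(* A homeomorphism from an open subset of M onto a relatively open subset of
   the half-space; chart_inv is relevant on chart_img only. *)
Record chart (R : realType) (d : nat) (M : topologicalType) := Chart {
  chart_dom : set M;
  chart_map : M -> 'rV[R]_d.+1;
  chart_inv : 'rV[R]_d.+1 -> M;
  chart_dom_open : open chart_dom;
  chart_img_open : exists2 O : set 'rV[R]_d.+1, open O &
    chart_map @` chart_dom = O `&` half_space;
  chart_mapK : forall p, chart_dom p -> chart_inv (chart_map p) = p;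
  chart_map_cont : {within chart_dom, continuous chart_map};
  chart_inv_cont : {within chart_map @` chart_dom, continuous chart_inv} }.

Section Charts.
Context {R : realType} {d : nat} {M : topologicalType}.
Implicit Types (c : chart R d M) (A : set (chart R d M)).

Definition chart_img c : set 'rV[R]_d.+1 := chart_map c @` chart_dom c.

Definition overlap c1 c2 : set 'rV[R]_d.+1 :=
  chart_map c1 @` (chart_dom c1 `&` chart_dom c2).

Definition transition c1 c2 (x : 'rV[R]_d.+1) : 'rV[R]_d.+1 :=
  chart_map c2 (chart_inv c1 x).

Definition compatible c1 c2 : Prop := forall k,
  smooth_on (overlap c1 c2) (fun x => transition c1 c2 x ord0 k) /\
  smooth_on (overlap c2 c1) (fun x => transition c2 c1 x ord0 k).

Definition smooth_atlas A : Prop :=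
  (forall p : M, exists2 c, A c & chart_dom c p) /\
  (forall c1 c2, A c1 -> A c2 -> compatible c1 c2).

End Charts.

(* Smooth manifold of dimension d.+1 with (possibly empty) boundary *)
Record manifold (R : realType) (d : nat) := Manifold {
  carrier :> topologicalType;
  atlas : set (chart R d carrier);
  manifold_hausdorff : hausdorff_space carrier;
  manifold_second_countable : @second_countable carrier;
  manifold_atlas : smooth_atlas atlas }.

Record metric (R : realType) (d : nat) (M : manifold R d) := Metric {
  metric_mx :> chart R d M -> 'rV[R]_d.+1 -> 'M[R]_d.+1;
  metric_smooth : forall c, atlas c -> forall i j,
    smooth_on (chart_img c) (fun x => metric_mx c x i j);
  metric_sym : forall c x, atlas c -> chart_img c x ->
    (metric_mx c x)^T = metric_mx c x;
  metric_pos : forall c x (v : 'rV[R]_d.+1), atlas c -> chart_img c x ->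
    v != 0 -> 0 < (v *m metric_mx c x *m v^T) ord0 ord0;
  metric_change : forall c1 c2 x, atlas c1 -> atlas c2 -> overlap c1 c2 x ->
    metric_mx c1 x = jac (transition c1 c2) x
      *m metric_mx c2 (transition c1 c2 x) *m (jac (transition c1 c2) x)^T }.

Section Geometry.
Context {R : realType} {d : nat} {M : manifold R d}.

Definition boundary : set M :=
  [set p | exists c, [/\ atlas c, chart_dom c p & chart_map c p ord0 ord0 = 0]].

(* Existence of an oriented atlas defining the same smooth structure. Charts
   into a fixed half-space make this adequate in dimension >= 2 only: the
   one-dimensional segment has no such atlas. *)
Definition orientable : Prop := exists B : set (chart R d M),
  [/\ smooth_atlas B,
      (forall c b, atlas c -> B b -> compatible c b) &
      forall b1 b2 x, B b1 -> B b2 -> overlap b1 b2 x ->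
        0 < \det (jac (transition b1 b2) x)].

Definition smooth (V : M -> R) : Prop :=
  forall c, atlas c -> smooth_on (chart_img c) (V \o chart_inv c).

Definition static_interior (g : metric M) (V : M -> R) : Prop :=
  forall c x, atlas c -> chart_img c x ->
    let f := V \o chart_inv c in
    hess (g c) f x - laplacian (g c) f x *: g c x - f x *: ricci (g c) x = 0.

(* The indices i, j != ord0 are those of the vectors tangent to the boundary. *)
Definition static_boundary (g : metric M) (V : M -> R) : Prop :=
  forall c x, atlas c -> chart_img c x -> x ord0 ord0 = 0 ->
    let f := V \o chart_inv c in
    forall i j, i != ord0 -> j != ord0 ->
      normal_derivative (g c) f x * g c x i j - f x * second_ff (g c) x i j = 0.

Definition static_manifold (g : metric M) (V : M -> R) : Prop :=
  [/\ smooth V, (exists p, V p != 0), static_interior g V &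
      static_boundary g V].

(* The scalar curvature equals (dim M - 1) * Lambda. *)
Definition cosmological_constant (g : metric M) (Lambda : R) : Prop :=
  forall c x, atlas c -> chart_img c x ->
    scalar (g c) x = (d.+1%:R - 1) * Lambda.

End Geometry.
Arguments boundary {R d} M.
Arguments orientable {R d} M.

Definition components (T : topologicalType) (A : set T) : set (set T) :=
  connected_component A @` A.

(* Main.v *)
Require Import Defs.
From HB Require Import structures.
From mathcomp Require Import all_boot all_order all_algebra.
From mathcomp Require Import all_classical all_reals all_analysis.
From mathcomp Require Import ring lra.
Set Implicit Arguments.
Unset Strict Implicit.
Unset Printing Implicit Defensive.
Import Order.TTheory GRing.Theory Num.Theory.
Import numFieldNormedType.Exports.
Local Open Scope classical_set_scope.
Local Open Scope ring_scope.

(** Tracing the static equation gives lap V = - Lambda V, where - Lambda >= 0: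
    V solves a linear elliptic equation that obeys the strong minimum principle
    at nonpositive minima.

    Suppose that V has no zero on the boundary. The boundary is connected and
    nonempty, so V has a constant sign there; after multiplication by a
    constant s, V is positive on it. Let m be the minimum of V on the compact
    manifold. If m > 0, V does not vanish. If m <= 0, the set where V = m is
    disjoint from the boundary, closed, and, by the strong minimum principle,
    open (static_level_set_open). By connectedness it is the whole manifold,
    which contradicts the positivity of V on the boundary.

    The strong minimum principle (strong_minimum_principle) is proved in
    coordinates with Hopf's barrier (no_touching_ball). It rests on the
    comparison of second-order operators at a touching point
    (second_order_op_touching), which combines the second derivative test along
    lines with the positivity of the trace of a positive semidefinite form
    against a positive definite matrix (trace_form_ge0). Near an interior point
    of a chart the Laplacian is such an operator, with continuous coefficients
    (laplacianE), because the one-sided partial derivatives are ordinary ones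
    there (partialE). *)

(** * Positive definite matrices *)

Definition posdef (R : numDomainType) n (A : 'M[R]_n) : Prop :=
  A^T = A /\ forall v : 'rV_n, v != 0 -> 0 < (v *m A *m v^T) ord0 ord0.

(** Induction on the dimension: after splitting off the first basis vector, the
    Schur complement of the corner entry is again positive definite. *)
Lemma cholesky (R : rcfType) n (A : 'M[R]_n) :
  posdef A -> exists Q : 'M[R]_n, A = Q *m Q^T.
Proof.
elim: n => [|n IHn] in A *; first by exists 0; rewrite [A]flatmx0 [RHS]flatmx0.
rewrite -[n.+1]/(1 + n)%N in A * => -[symA posA].
pose b := ursubmx A; pose C := drsubmx A; pose a := A ord0 ord0.
have symC : C^T = C by rewrite /C trmx_drsub symA.
have bE : dlsubmx A = b^T by rewrite /b trmx_ursub symA.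
have aE : ulsubmx A = a%:M.
  by rewrite [LHS]mx11_scalar !mxE; congr (A _ _)%:M; apply/val_inj.
have AE : A = block_mx a%:M b b^T C by rewrite -aE -bE submxK.
have agt0 : 0 < a.
  have := posA (row_mx 1%:M 0); rewrite AE tr_row_mx mul_row_block !mul0mx !addr0.
  rewrite mul_row_col trmx0 mulmx0 addr0 !trmx1 mulmx1 mul1mx !mxE eqxx mulr1n.
  apply; apply/eqP => /matrixP/(_ ord0 (lshift n ord0)).
  by rewrite row_mxEl !mxE eqxx => /eqP; rewrite oner_eq0.
pose S := C - a^-1 *: (b^T *m b).
have [Q' SE] : exists Q' : 'M[R]_n, S = Q' *m Q'^T.
  apply: IHn; split=> [|v v0]; first by rewrite /S linearB linearZ /= trmx_mul trmxK symC.
  (* the vector extending v that is A-orthogonal to the first basis vector *)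
  have := posA (row_mx (- a^-1 *: (v *m b^T)) v).
  rewrite AE tr_row_mx mul_row_block mul_row_col.
  rewrite mul_mx_scalar scalerA mulrN divff ?gt_eqF// scaleN1r addNr mul0mx add0r.
  rewrite /S mulmxBr -scalemxAl -scalemxAr mulmxA !scaleNr [_ + v *m C]addrC.
  apply; apply: contraNneq v0 => /eqP; rewrite row_mx_eq0 => /andP[_ /eqP->].
  by [].
pose s := Num.sqrt a.
have s0 : s != 0 by rewrite gt_eqF// sqrtr_gt0.
have ss : s * s = a by rewrite -expr2 sqr_sqrtr// ltW.
exists (block_mx s%:M 0 (s^-1 *: b^T) Q' : 'M[R]_(1 + n)).
rewrite AE tr_block_mx mulmx_block trmx0 !mulmx0 !addr0 mul0mx addr0.
rewrite tr_scalar_mx linearZ /= trmxK -scalar_mxM ss.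
rewrite mul_scalar_mx scalerA divff// scale1r mul_mx_scalar scalerA divff// scale1r.
rewrite -SE -scalemxAl -scalemxAr scalerA -invfM ss /S addrC subrK.
by [].
Qed.

(** With A = Q Q^T, the trace of A against H is the sum of the values of the
    quadratic form H on the columns of Q. *)
Lemma trace_form_ge0 (R : rcfType) n (A H : 'M[R]_n) : posdef A ->
  (forall v : 'rV_n, 0 <= \sum_i \sum_j v ord0 i * v ord0 j * H i j) ->
  0 <= \sum_i \sum_j A i j * H i j.
Proof.
move=> posA Hge0; have [Q ->] := cholesky posA.
under eq_bigr => i _ do under eq_bigr => j _ do
  (rewrite mxE mulr_suml; under eq_bigr => k _ do rewrite mxE).
under eq_bigr => i _ do rewrite exchange_big.
rewrite exchange_big; apply: sumr_ge0 => k _ /=.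
have := Hge0 (row k Q^T); congr (_ <= _).
by apply: eq_bigr => i _; apply: eq_bigr => j _; rewrite !mxE.
Qed.

Lemma posdef_unit (R : numFieldType) n (A : 'M[R]_n) : posdef A -> A \in unitmx.
Proof.
move=> [_ posA]; rewrite -row_free_unit -kermx_eq0.
apply/negPn/negP => /rowV0Pn[v vA v0]; have := posA v v0.
by rewrite (sub_kermxP vA) mul0mx mxE ltxx.
Qed.

Lemma posdef_inv (R : numFieldType) n (A : 'M[R]_n) :
  posdef A -> posdef (invmx A).
Proof.
move=> pA; have uA := posdef_unit pA; have [symA posA] := pA.
have symI : (invmx A)^T = invmx A by rewrite trmx_inv symA.
split=> // v v0; have := posA (v *m invmx A).
rewrite trmx_mul symI mulmxKV// mulmxA; apply.
by apply: contra_neq v0 => vI; rewrite -(mulmxKV uA v) vI mul0mx.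
Qed.

Lemma quad_formE (R : comNzRingType) n (A : 'M[R]_n) (v : 'rV_n) :
  (v *m A *m v^T) ord0 ord0 = \sum_i \sum_j A i j * (v ord0 i * v ord0 j).
Proof.
rewrite exchange_big mxE; apply: eq_bigr => j _.
rewrite !mxE mulr_suml; apply: eq_bigr => i _.
by rewrite mulrA [A i j * _]mulrC.
Qed.

(** * Directional derivatives and the second derivative test *)

Section LineCalculus.
Context {R : realType}.

(** The mean value theorem without an assumption on the order of the endpoints,
    because the increments h * a below have arbitrary sign. *)
Lemma mean_value (f f' : R -> R) (a b : R) :
  (forall t, `|t - a| <= `|b - a| -> is_derive t 1 f (f' t)) ->
  exists2 t, `|t - a| <= `|b - a| & f b - f a = f' t * (b - a).
Proof.
move=> df; have cont t : `|t - a| <= `|b - a| -> {for t, continuous f}.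
  by move=> /df[+ _] => /derivable1_diffP/differentiable_continuous.
have [ab|ba] := leP a b.
- have sub t : t \in `[a, b]%R -> `|t - a| <= `|b - a|.
    by rewrite in_itv/= => /andP[? ?]; rewrite !ger0_norm ?subr_ge0// lerB.
  have [|| t tab ->] := @MVT_segment R f f' a b ab.
  + by move=> t tab; apply/df/sub/subset_itv_oo_cc.
  + apply/continuous_in_subspaceT => t; rewrite inE => tab.
    exact/cont/sub.
  by exists t => //; exact: sub.
- have sub t : t \in `[b, a]%R -> `|t - a| <= `|b - a|.
    rewrite in_itv/= => /andP[? ?].
    by rewrite !ler0_norm ?subr_le0// ?lerN2 ?lerB// ltW.
  have [|| t tab e] := @MVT_segment R f f' b a (ltW ba).
  + by move=> t tab; apply/df/sub/subset_itv_oo_cc.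
  + apply/continuous_in_subspaceT => t; rewrite inE => tab.
    exact/cont/sub.
  exists t; first exact: sub.
  by rewrite -[LHS]opprB e -mulrN opprB.
Qed.


Lemma is_derive_along (E : normedModType R) (f : E -> R) (x v : E) (t : R) df :
  is_derive (x + t *: v) v f df -> is_derive t 1 (fun s => f (x + s *: v)) df.
Proof.
case=> df1 df2.
have e : (fun h : R => h^-1 *: (((fun s => f (x + s *: v)) \o shift t) (h *: 1)
     - f (x + t *: v))) =
   (fun h => h^-1 *: ((f \o shift (x + t *: v)) (h *: v) - f (x + t *: v))).
  apply/funext => h /=; rewrite [h *: 1]mulr1 scalerDl.
  by rewrite addrA addrAC [_ + h *: v]addrC addrA.
by apply: DeriveDef; rewrite /derivable /derive e.
Qed.

(** The increment along v + a e is that along v followed by one along e; the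
    mean value theorem turns the latter into a value of 'D_e f at a nearby point,
    and 'D_e f is continuous at x. Only the derivative at x itself is required
    along v, which is what lets one add the coordinate directions one by one. *)
Lemma is_deriveD_dir (E : normedModType R) (f : E -> R) (x v e : E) (a dv : R) :
  is_derive x v f dv -> (\near x, derivable f x e) ->
  {for x, continuous ('D_e f)} ->
  is_derive x (v + a *: e) f (dv + a * 'D_e f x).
Proof.
move=> dfv dfe cfe.
suff q2 : h^-1 * (f (h *: (v + a *: e) + x) - f (h *: v + x)) @[h --> 0^']
    --> a * 'D_e f x.
  have cv : h^-1 *: ((f \o shift x) (h *: (v + a *: e)) - f x) @[h --> 0^']
      --> dv + a * 'D_e f x.
    rewrite (_ : (fun h => _) = (fun h : R =>
        h^-1 *: ((f \o shift x) (h *: v) - f x)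
        + h^-1 * (f (h *: (v + a *: e) + x) - f (h *: v + x)))); last first.
      by apply/funext => h /=; rewrite -[RHS]mulrDr; congr (_ * _); ring.
    by apply: cvgD => //; case: dfv => + <-.
  by apply: DeriveDef; [apply/cvg_ex; eexists; exact: cv|exact: cvg_lim cv].
apply/cvgrPdist_le => /= eps eps0.
have [d d0 Hd] : exists2 d : R, 0 < d & forall z, `|z - x| < d ->
    derivable f z e /\ `|'D_e f z - 'D_e f x| < eps / (`|a| + 1).
  have e1 : 0 < eps / (`|a| + 1) by rewrite divr_gt0// ltr_wpDl.
  have /cvgrPdist_lt/(_ _ e1) ce := cfe.
  have /nbhs_ballP[d /= d0 Hd] : \forall z \near x, derivable f z e /\
      `|'D_e f x - 'D_e f z| < eps / (`|a| + 1) by exact: filterI dfe ce.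
  exists d; [exact: d0|move=> z zx]; have [|dz Hz] := Hd z.
    by rewrite -ball_normE/= distrC.
  by split; [apply: dz|rewrite distrC].
near=> h.
have h0 : h != 0 by near: h; exact: nbhs_dnbhs_neq.
have small s : `|s| <= `|h * a| -> `|h *: v + x + s *: e - x| < d.
  move=> sh; rewrite addrAC addrK.
  apply: (@le_lt_trans _ _ (`|h| * (`|v| + `|a| * `|e|))).
    rewrite (le_trans (ler_normD _ _))// !normrZ mulrDr mulrA -normrM.
    by rewrite lerD2l ler_wpM2r.
  rewrite (@le_lt_trans _ _ (`|h| * (`|v| + `|a| * `|e| + 1)))//.
    by rewrite ler_wpM2l// lerDl.
  rewrite -ltr_pdivlMr ?ltr_wpDl ?addr_ge0 ?mulr_ge0//.
  near: h; apply: dnbhs0_lt; rewrite divr_gt0// ltr_wpDl ?addr_ge0 ?mulr_ge0//.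
have [|s sh] := @mean_value (fun s => f (h *: v + x + s *: e))
    (fun s => 'D_e f (h *: v + x + s *: e)) 0 (h * a).
  rewrite !subr0 => s; rewrite subr0 => /small/Hd[+ _].
  by move=> /derivableP; apply: is_derive_along.
rewrite !subr0 in sh *; rewrite scale0r addr0 scalerDr scalerA.
rewrite [h *: v + _ + x]addrAC => ->.
rewrite mulrCA mulKf// [_ * a]mulrC -mulrBr normrM distrC.
have [|_ /ltW Ds] := Hd (h *: v + x + s *: e); first by apply: small.
rewrite (le_trans (ler_wpM2l _ Ds))// mulrCA ler_piMr ?(ltW eps0)//.
by rewrite ler_pdivrMr ?ltr_wpDl// mul1r lerDl.
Unshelve. all: by end_near. Qed.

Lemma near_line (E : normedModType R) (P : set E) (x v : E) :
  (\near x, P x) -> exists2 e : R, 0 < e & forall t : R, `|t| < e -> P (x + t *: v).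
Proof.
move=> Px; have cl : (fun t : R => x + t *: v) @ 0 --> x.
  rewrite -[X in _ --> X]addr0 -(scale0r v).
  by apply: cvgD; [exact: cvg_cst|apply: cvgZr_tmp; exact: cvg_id].
have /nbhs_ballP[e /= e0 He] := cl _ Px.
by exists e => // t te; apply: He; rewrite /ball/= sub0r normrN.
Qed.

(** If c were negative, then p' would be negative just to the right of 0 and p
    would drop below p 0 there. *)
Lemma second_derivative_test1 (p p' : R -> R) (c e : R) : 0 < e ->
  (forall t : R, `|t| < e -> is_derive t 1 p (p' t)) ->
  is_derive (0 : R) 1 p' c ->
  (forall t : R, `|t| < e -> p 0 <= p t) -> p' 0 = 0 /\ 0 <= c.
Proof.
move=> e0 dp [p'cv p'E] pmin.
have crit : p' 0 = 0.
  have e_itv (t : R) : t \in `](- e), e[%R -> `|t| < e.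
    by rewrite in_itv/= -ltr_norml.
  have [||||_ D0] := @derive1_at_min R p (- e) e 0.
  + by rewrite (@ge0_cp _ e) ?ltW.
  + by move=> t /e_itv/dp[].
  + by rewrite in_itv/= oppr_lt0 e0.
  + by move=> t /e_itv/pmin.
  by have [|_ pE] := dp 0; rewrite ?normr0// -pE.
split=> //; rewrite leNgt; apply/negP => neg.
have : \forall t \near 0^', t^-1 *: (p' (t *: 1 + 0) - p' 0) < 0.
  move: p'cv; rewrite /derivable => /cvgr_lt/(_ 0); apply.
  by move: p'E; rewrite /derive => ->.
rewrite near_withinE => /nbhs_ballP[r /= r0 Hr].
have [t [t0 tr te]] : exists t : R, [/\ 0 < t, t < r & t < e].
  exists (Num.min (r / 2) (e / 2)); split; first by rewrite lt_min !divr_gt0.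
  - by rewrite gt_min ltr_pdivrMr// ltr_pMr// ltr1n.
  - by rewrite gt_min [e / 2 < _]ltr_pdivrMr// (ltr_pMr _ e0) ltr1n orbT.
have [||s] := @MVT R p p' 0 t t0.
- move=> s; rewrite in_itv/= => /andP[s0 st]; apply: dp.
  by rewrite gtr0_norm// (lt_trans st).
- apply/continuous_in_subspaceT => s; rewrite inE/= in_itv/= => /andP[s0 st].
  apply/differentiable_continuous/derivable1_diffP.
  by have [|//] := dp s; rewrite ger0_norm// (le_lt_trans st).
rewrite in_itv/= => /andP[s0 st]; rewrite subr0 => pE.
have p's : p' s < 0.
  have := Hr s; rewrite /ball/= sub0r normrN gtr0_norm// (lt_trans st)//.
  rewrite gt_eqF// => /(_ isT isT).
  by rewrite crit subr0 addr0 [_ *: 1]mulr1 pmulr_rlt0// invr_gt0.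
have [|] := leP (p 0) (p t).
  by rewrite -subr_ge0 pE pmulr_lge0// leNgt p's.
by rewrite ltNge pmin// gtr0_norm.
Qed.

Lemma second_derivative_test (E : normedModType R) (w : E -> R) (y v : E) :
  (\near y, derivable w y v) -> derivable ('D_v w) y v ->
  (\forall z \near y, w y <= w z) ->
  'D_v w y = 0 /\ 0 <= 'D_v ('D_v w) y.
Proof.
move=> dw ddw wmin.
have [e e0 He] := near_line v (filterI dw wmin).
have := @second_derivative_test1 (fun t => w (y + t *: v))
  (fun t => 'D_v w (y + t *: v)) ('D_v ('D_v w) y) e e0.
rewrite scale0r addr0; apply.
- by move=> t /He[/derivableP ? _]; apply: is_derive_along.
- apply: (@is_derive_along E ('D_v w) y v); rewrite scale0r addr0.
  exact: derivableP.
- by move=> t /He[].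
Qed.

End LineCalculus.

Section Partials.
Context {R : realType} {d : nat}.
Local Notation E := 'rV[R]_d.+1.
Implicit Types (U : set E) (f F : E -> R).

Lemma CkS k U F : Ck k.+1 U F -> Ck k U F.
Proof.
elim: k F => [|k IHk] F [cF dF]; split=> // i.
by have [? ?] := dF i; split=> //; exact: IHk.
Qed.

Lemma Ck_continuous k U F : Ck k U F -> forall x, U x -> {for x, continuous F}.
Proof. by case: k => [|k] []. Qed.

(** Turns the local extensions that define smoothness into one C^k function on an
    open set, and transports C^k regularity between functions equal on U. *)
Lemma Ck_eq_local k U F : open U ->
  (forall x, U x -> exists W G, [/\ open W, W x, Ck k W G &
     forall y, W y -> U y -> F y = G y]) -> Ck k U F.
Proof.
move=> oU; elim: k F => [|k IHk] F loc.
  split=> // x Ux; have [W [G [oW Wx [cG _] FG]]] := loc x Ux.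
  have FGx : \forall y \near x, G y = F y.
    by near=> y; rewrite FG//; near: y; exact: open_nbhs_nbhs.
  change (F @ x --> F x); rewrite -(nbhs_singleton FGx).
  apply: cvg_trans (cG x Wx).
  exact: (near_eq_cvg FGx).
split=> [|i].
  apply: (Ck_continuous (k := k)); apply: IHk => x Ux; have [W [G [? ? /CkS ? ?]]] := loc x Ux.
  by exists W, G.
have eqn W G y : open W -> (forall y, W y -> U y -> F y = G y) -> W y -> U y ->
    \forall z \near y, G z = F z.
  by move=> oW FG Wy Uy; near=> z; rewrite FG//; near: z; exact: open_nbhs_nbhs.
split=> [x Ux|].
  have [W [G [oW Wx [_ /(_ i)[dG _]] FG]]] := loc x Ux.
  exact: near_eq_derivable (eqn _ _ _ oW FG Wx Ux) (dG x Wx).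
apply: IHk => x Ux; have [W [G [oW Wx [_ /(_ i)[_ CG]] FG]]] := loc x Ux.
exists W, ('D_(evec i) G); split=> // y Wy Uy.
by apply: near_eq_derive; apply: filterS (eqn _ _ _ oW FG Wy Uy) => z /esym.
Unshelve. all: by end_near. Qed.

(** Continuous partial derivatives determine all directional derivatives. *)
Lemma is_derive_partials U F (x v : E) : open U -> Ck 1 U F -> U x ->
  is_derive x v F (\sum_i v ord0 i * 'D_(evec i) F x).
Proof.
move=> oU [_ dF] Ux; rewrite {1}[v]row_sum_delta.
elim/big_rec2 : _ => [|i e dv _ IH]; first exact: is_derive0.
rewrite addrC [X in is_derive _ _ _ X]addrC; have [di [ci _]] := dF i.
apply: is_deriveD_dir => //; last exact: ci.
by near=> z; apply: di; near: z; exact: open_nbhs_nbhs.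
Unshelve. all: by end_near. Qed.

Lemma is_derive_partials2 U F (x v : E) : open U -> Ck 2 U F -> U x ->
  is_derive x v ('D_v F)
   (\sum_i \sum_j v ord0 i * v ord0 j * 'D_(evec i) ('D_(evec j) F) x).
Proof.
move=> oU C2 Ux; have C1 := CkS C2.
have -> : \sum_i \sum_j v ord0 i * v ord0 j * 'D_(evec i) ('D_(evec j) F) x =
    \sum_j v ord0 j *: \sum_i v ord0 i * 'D_(evec i) ('D_(evec j) F) x.
  rewrite exchange_big/=; apply: eq_bigr => j _.
  rewrite [RHS]mulr_sumr; apply: eq_bigr => i _; ring.
have nE : \forall z \near x,
    (\sum_j v ord0 j *: 'D_(evec j) F) z = 'D_v F z.
  near=> z; have Uz : U z by near: z; exact: open_nbhs_nbhs.
  by rewrite fct_sumE; have [_ ->] := is_derive_partials v oU C1 Uz.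
apply: near_eq_is_derive nE _.
apply: is_derive_sum => j; apply: is_deriveZ.
by apply: is_derive_partials oU _ Ux; case: C2 => _ /(_ j)[].
Unshelve. all: by end_near. Qed.

End Partials.

(** * Euclidean balls *)

Section BigContinuity.
Context {R : realType} {T : topologicalType} {I : Type}.
Variables (r : seq I) (P : pred I) (f : I -> T -> R) (x : T).
Hypothesis cf : forall i, P i -> {for x, continuous (f i)}.

Lemma continuous_sum :
  {for x, continuous (fun z => \sum_(i <- r | P i) f i z)}.
Proof. by apply: cvg_big => // z; apply: cvgD; [exact: cvg_fst|exact: cvg_snd]. Qed.

Lemma continuous_prod :
  {for x, continuous (fun z => \prod_(i <- r | P i) f i z)}.
Proof. by apply: cvg_big => // z; apply: cvgM; [exact: cvg_fst|exact: cvg_snd]. Qed.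

End BigContinuity.

Section Euclidean.
Context {R : realType} {d : nat}.
Local Notation E := 'rV[R]_d.+1.
Implicit Types (x y z p q u v : E) (U K : set E) (F P : E -> R).

(** The norm of row vectors is the sup norm; the barrier argument needs balls
    with smooth boundary, hence the Euclidean product. *)
Definition dot u v : R := \sum_i u ord0 i * v ord0 i.

Lemma dot_evec u i : dot u (evec i) = u ord0 i.
Proof.
rewrite /dot (bigD1 i)//= big1 ?addr0; first by rewrite mxE !eqxx mulr1.
by move=> j ji; rewrite mxE eqxx (negbTE ji) mulr0.
Qed.

Lemma dot_ge0 u : 0 <= dot u u.
Proof. by apply: sumr_ge0 => i _; rewrite -expr2 sqr_ge0. Qed.

Lemma dot0 u : dot 0 u = 0.
Proof. by apply: big1 => i _; rewrite mxE mul0r. Qed.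

Lemma coord_le_dot u i : u ord0 i ^+ 2 <= dot u u.
Proof.
rewrite /dot (bigD1 i)//= expr2 lerDl.
by apply: sumr_ge0 => j _; rewrite -expr2 sqr_ge0.
Qed.

Lemma dotD_le u v : dot (u + v) (u + v) <= 2 * (dot u u + dot v v).
Proof.
rewrite /dot -big_split/= mulr_sumr; apply: ler_sum => i _; rewrite mxE.
rewrite -subr_ge0 (_ : _ - _ = (u ord0 i - v ord0 i) ^+ 2) ?sqr_ge0//.
ring.
Qed.

Lemma dotN u : dot (- u) (- u) = dot u u.
Proof. by apply: eq_bigr => i _; rewrite mxE mulrNN. Qed.

Lemma continuous_coordB q i : continuous (fun z => (z - q) ord0 i).
Proof.
rewrite (_ : (fun z => _) = (fun z => z ord0 i - q ord0 i)); last first.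
  by apply/funext => z; rewrite !mxE.
move=> z; apply: (@continuousB R R^o _ (fun z : E => z ord0 i) (cst (q ord0 i))).
  exact: coord_continuous.
exact: cst_continuous.
Qed.

Lemma continuous_dot q u : continuous (fun z => dot (z - q) u).
Proof.
move=> z; apply: continuous_sum => i _.
exact: (continuousM (@continuous_coordB q i z) (@cst_continuous _ _ _ z)).
Qed.

Lemma continuous_sqn q : continuous (fun z => dot (z - q) (z - q)).
Proof.
move=> z; apply: continuous_sum => i _.
exact: (continuousM (@continuous_coordB q i z) (@continuous_coordB q i z)).
Qed.

Lemma is_derive_coord x v i : is_derive x v (fun z => z ord0 i) (v ord0 i).
Proof.
have dx : derivable (@id E) x v by exact: derivable_id.
apply: DeriveDef; first by have /derivable_mxP := dx; apply.
by have := derive_mx dx; rewrite derive_id => /rowP/(_ i) ->; rewrite mxE.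
Qed.

Lemma is_derive_dot x v q u : is_derive x v (fun z => dot (z - q) u) (dot v u).
Proof.
rewrite (_ : (fun z => _) =
    \sum_i (u ord0 i *: ((fun z => z ord0 i) - cst (q ord0 i)))); last first.
  apply/funext => z; rewrite fct_sumE; apply: eq_bigr => i _.
  by rewrite !mxE mulrC.
apply: is_derive_sum => i; rewrite mulrC.
apply: is_deriveZ; rewrite -[X in is_derive _ _ _ X]subr0.
by apply: is_deriveB; exact: is_derive_coord.
Qed.

Lemma is_derive_sqn x v q :
  is_derive x v (fun z => dot (z - q) (z - q)) (2 * dot (x - q) v).
Proof.
rewrite (_ : (fun z => _) =
    \sum_i ((fun z => z ord0 i) - cst (q ord0 i)) ^+ 2); last first.
  by apply/funext => z; rewrite fct_sumE; apply: eq_bigr => i _; rewrite !mxE.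
rewrite /dot mulr_sumr; apply: is_derive_sum => i.
have di : is_derive x v ((fun z => z ord0 i) - cst (q ord0 i)) (v ord0 i).
  rewrite -[X in is_derive _ _ _ X]subr0.
  by apply: is_deriveB; exact: is_derive_coord.
apply: is_derive_eq; rewrite expr1 !mxE.
by rewrite [LHS]/GRing.scale/= mulrA.
Qed.

Lemma near_dot_ball p (Q : set E) : (\near p, Q p) ->
  exists2 e : R, 0 < e & forall z, dot (z - p) (z - p) <= e -> Q z.
Proof.
move=> /nbhs_ballP[r /= r0 Hr]; exists ((r / 2) ^+ 2).
  by rewrite exprn_gt0// divr_gt0.
move=> z zp; apply: Hr; rewrite -ball_normE/= distrC.
apply: (@le_lt_trans _ _ (r / 2)); last by rewrite ltr_pdivrMr// ltr_pMr// ltr1n.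
rewrite [leLHS]/Num.Def.normr/= mx_normrE.
apply: bigmax_le => [|[i j] _]; first by rewrite divr_ge0// ltW.
rewrite ord1 -(ler_pXn2r (n := 2))// ?nnegrE ?divr_ge0 ?(ltW r0)//.
by rewrite real_normK ?num_real// (le_trans (coord_le_dot _ _)).
Qed.

Lemma open_dot_ball p x (e : R) : dot (x - p) (x - p) < e ->
  \forall z \near x, dot (z - p) (z - p) < e.
Proof.
move=> xp; exact: (@cvgr_lt R E (nbhs x) _ _ _ (@continuous_sqn p x) _ xp).
Qed.

Lemma closed_dot_ball p (e : R) : closed [set z | dot (z - p) (z - p) <= e].
Proof.
apply: (@preimage_closed _ _ (fun z => dot (z - p) (z - p)) [set r | r <= e]).
  by move=> z _; exact: continuous_sqn.
exact: closed_le.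
Qed.

Lemma compact_dot_ball p (e : R) : compact [set z | dot (z - p) (z - p) <= e].
Proof.
apply: bounded_closed_compact; last exact: closed_dot_ball.
exists (`|p| + (e + 1)); split; first exact: num_real.
move=> M ltM z /= zp; apply: le_trans (ltW ltM).
rewrite -[z in `|z|](subrKC p) (le_trans (ler_normD _ _))// lerD2l.
have e0 : 0 <= e := le_trans (dot_ge0 _) zp.
rewrite [leLHS]/Num.Def.normr/= mx_normrE.
apply: bigmax_le => [|[i j] _]; first by rewrite addr_ge0.
rewrite ord1/= -(ler_pXn2r (n := 2))// ?nnegrE ?addr_ge0//.
rewrite real_normK ?num_real// (le_trans (coord_le_dot _ _))//.
by rewrite (le_trans zp)// expr2 mulrDl mulrDr !mulr1 mul1r; nra.
Qed.

Lemma attains_min K F : compact K -> K !=set0 ->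
  (forall z, K z -> {for z, continuous F}) ->
  exists2 c, K c & forall z, K z -> F c <= F z.
Proof.
move=> cK K0 cF; have [|c cK' Hc] := EVT_min_rV K0 cK (f := F).
  by apply: continuous_in_subspaceT => z; rewrite inE; exact: cF.
by exists c; [rewrite inE in cK'|move=> z Kz; apply: Hc; rewrite inE].
Qed.

End Euclidean.

(** * Second-order operators and the barrier *)

Section MaximumPrinciple.
Context {R : realType} {d : nat}.
Local Notation E := 'rV[R]_d.+1.
Implicit Types (x y z p q u v : E) (U K : set E) (F P : E -> R).
Implicit Types (A : E -> 'M[R]_d.+1) (b : E -> 'I_d.+1 -> R).

Definition second_order_op A b F x :=
  \sum_i \sum_j A x i j * 'D_(evec i) ('D_(evec j) F) x
  - \sum_k b x k * 'D_(evec k) F x.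

Lemma continuous_second_order_op A b U F x : Ck 2 U F -> U x ->
  (forall i j, {for x, continuous (fun z => A z i j)}) ->
  (forall k, {for x, continuous (fun z => b z k)}) ->
  {for x, continuous (second_order_op A b F)}.
Proof.
move=> [_ C2] Ux cA cb.
apply: (@continuousB R R^o _ (fun z => \sum_i \sum_j _) (fun z => \sum_k _)).
- apply: continuous_sum => i _; apply: continuous_sum => j _.
  have [_ [_ C1]] := C2 j; have [_ [C0 _]] := C1 i.
  exact: (continuousM (cA i j) (C0 x Ux)).
- apply: continuous_sum => k _; have [_ [C0 _]] := C2 k.
  exact: (continuousM (cb k) (C0 x Ux)).
Qed.

(** At a minimum of F - P the gradient of F - P vanishes and its Hessian is
    positive semidefinite, so that the trace of the Hessian against A y is
    nonnegative. *)
Lemma second_order_op_touching A b U F P y : open U -> Ck 2 U F -> Ck 2 U P ->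
  U y -> posdef (A y) -> (\forall z \near y, F y - P y <= F z - P z) ->
  second_order_op A b P y <= second_order_op A b F y.
Proof.
move=> oU CF CP Uy pA ymin.
have D1 z v : U z -> is_derive z v (F \- P) ('D_v F z - 'D_v P z).
  move=> Uz; have [dF _] := is_derive_partials v oU (CkS CF) Uz.
  have [dP _] := is_derive_partials v oU (CkS CP) Uz.
  by apply: is_deriveB; exact: derivableP.
have nU : \near y, U y by exact: open_nbhs_nbhs.
have D2 v : is_derive y v ('D_v (F \- P))
    (\sum_i \sum_j v ord0 i * v ord0 j * ('D_(evec i) ('D_(evec j) F) y
       - 'D_(evec i) ('D_(evec j) P) y)).
  have e : \forall z \near y, ('D_v F - 'D_v P) z = 'D_v (F \- P) z.
    by apply: filterS nU => z Uz; have [_ ->] := D1 z v Uz.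
  apply: near_eq_is_derive e _.
  apply: is_derive_eq; first by
    apply: is_deriveB; [exact: is_derive_partials2 oU CF Uy
                       |exact: is_derive_partials2 oU CP Uy].
  rewrite -sumrB; apply: eq_bigr => i _; rewrite -sumrB; apply: eq_bigr => j _.
  by rewrite mulrBr.
have test v : 'D_v F y = 'D_v P y /\
    0 <= \sum_i \sum_j v ord0 i * v ord0 j * ('D_(evec i) ('D_(evec j) F) y
       - 'D_(evec i) ('D_(evec j) P) y).
  have [] := @second_derivative_test R E (F \- P) y v.
  + by apply: filterS nU => z Uz; have [] := D1 z v Uz.
  + by have [] := D2 v.
  + exact: ymin.
  have [_ ->] := D1 y v Uy; have [_ ->] := D2 v.
  by move=> /eqP; rewrite subr_eq0 => /eqP.
apply: lerB; last first.
  by apply: ler_sum => k _; have [-> _] := test (evec k).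
rewrite -subr_ge0 -sumrB.
have := @trace_form_ge0 R _ (A y) (\matrix_(i, j) ('D_(evec i) ('D_(evec j) F) y
       - 'D_(evec i) ('D_(evec j) P) y)) pA.
under eq_bigr => i _ do under eq_bigr => j _ do rewrite mxE mulrBr.
under eq_bigr => i _ do rewrite sumrB.
apply => v; have [_] := test v; congr (_ <= _).
by apply: eq_bigr => i _; apply: eq_bigr => j _; rewrite mxE.
Qed.

Section Barrier.
Variables (q x0 : E) (k : R).

(** Positive inside the ball centred at q whose boundary passes through x0,
    zero on that boundary and negative outside. *)
Definition gap z : R := dot (x0 - q) (x0 - q) - dot (z - q) (z - q).

(** A large k makes the operator positive at x0: there the gap vanishes but its
    gradient does not, and the quadratic term contributes k times the square of
    the gradient. Subtracting the squared distance to x0 makes the barrier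
    nonpositive on the sphere, with x0 as its only zero there. *)
Definition barrier z : R := gap z + k * (gap z * gap z) - dot (z - x0) (z - x0).

Definition dbarrier v z : R :=
  (1 + 2 * k * gap z) * (- 2 * dot (z - q) v) - 2 * dot (z - x0) v.

Definition ddbarrier u v z : R :=
  8 * k * dot (z - q) u * dot (z - q) v
  - 2 * (1 + 2 * k * gap z) * dot u v - 2 * dot u v.

Lemma continuous_gap : continuous gap.
Proof.
by move=> z; exact: (continuousB (@cst_continuous _ _ _ z) (@continuous_sqn _ _ q z)).
Qed.

Lemma is_derive_gap z v : is_derive z v gap (- 2 * dot (z - q) v).
Proof.
rewrite mulNr -[X in is_derive _ _ _ X]sub0r.
exact: (is_deriveB (is_derive_cst _ z v) (is_derive_sqn z v q)).
Qed.

Lemma is_derive_barrier z v : is_derive z v barrier (dbarrier v z).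
Proof.
have dg := is_derive_gap z v.
have [D1 D2] := is_deriveB (is_deriveD dg (is_deriveZ k (is_deriveM dg dg)))
  (is_derive_sqn z v x0).
apply: DeriveDef; first exact: D1.
refine (etrans D2 _).
rewrite /dbarrier /GRing.scale/=; ring.
Qed.

Lemma is_derive_dbarrier z u v :
  is_derive z u (dbarrier v) (ddbarrier u v z).
Proof.
have dg := is_derive_gap z u.
have [D1 D2] := is_deriveB (is_deriveM (is_deriveD (is_derive_cst (1 : R) z u)
    (is_deriveZ (2 * k) dg)) (is_deriveZ (- 2 : R) (is_derive_dot z u q v)))
  (is_deriveZ (2 : R) (is_derive_dot z u x0 v)).
apply: DeriveDef; first exact: D1.
refine (etrans D2 _).
change ((1 + 2 * k * gap z) * (- 2 * dot u v)
  + (- 2 * dot (z - q) v) * (0 + 2 * k * (- 2 * dot (z - q) u))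
  - 2 * dot u v = ddbarrier u v z).
rewrite /ddbarrier; ring.
Qed.

Lemma barrier_Ck2 : Ck 2 setT barrier.
Proof.
have D1 v : 'D_v barrier = dbarrier v.
  by apply/funext => z; have [] := is_derive_barrier z v.
have D2 u v : 'D_u (dbarrier v) = ddbarrier u v.
  by apply/funext => z; have [] := is_derive_dbarrier z u v.
have cg := continuous_gap.
have cc (c : R) z : {for z, continuous (fun _ : E => c)} by exact: cst_continuous.
split=> [z _|i].
  exact: (continuousB (continuousD (cg z)
    (continuousM (cc k z) (continuousM (cg z) (cg z)))) (@continuous_sqn _ _ x0 z)).
split=> [z _|]; first by have [] := is_derive_barrier z (evec i).
rewrite D1; split=> [z _|j].
  exact: (continuousB
    (continuousM (continuousD (cc 1 z) (continuousM (cc (2 * k) z) (cg z)))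
      (continuousM (cc (- 2) z) (@continuous_dot _ _ q _ z)))
    (continuousM (cc 2 z) (@continuous_dot _ _ x0 _ z))).
split=> [z _|]; first by have [] := is_derive_dbarrier z (evec j) (evec i).
rewrite D2; split=> // z _.
exact: (continuousB (continuousB
  (continuousM (continuousM (cc (8 * k) z) (@continuous_dot _ _ q _ z))
    (@continuous_dot _ _ q _ z))
  (continuousM (continuousM (cc 2 z)
    (continuousD (cc 1 z) (continuousM (cc (2 * k) z) (cg z)))) (cc _ z)))
  (cc _ z)).
Qed.

Lemma barrier_center : barrier x0 = 0.
Proof. rewrite /barrier /gap !subrr dot0; ring. Qed.

Lemma second_order_op_barrier A b :
  second_order_op A b barrier x0 =
  8 * k * ((x0 - q) *m A x0 *m (x0 - q)^T) ord0 ord0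
  - (\sum_i \sum_j 4 * (A x0 i j * dot (evec i : E) (evec j))
     - \sum_l 2 * (b x0 l * dot (x0 - q) (evec l))).
Proof.
have D1 v z : 'D_v barrier z = dbarrier v z by have [] := is_derive_barrier z v.
have D2 u v z : 'D_u ('D_v barrier) z = ddbarrier u v z.
  have [_ <-] := is_derive_dbarrier z u v.
  by congr (derive _ _ _); apply/funext => y; exact: D1.
rewrite /second_order_op quad_formE mulr_sumr opprB addrA addrAC; congr (_ + _).
  rewrite -sumrB; apply: eq_bigr => i _; rewrite mulr_sumr -sumrB.
  apply: eq_bigr => j _; rewrite D2 /ddbarrier /gap subrr !dot_evec; ring.
rewrite -sumrN; apply: eq_bigr => l _.
rewrite D1 /dbarrier /gap !subrr dot0; ring.
Qed.

End Barrier.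

End MaximumPrinciple.

(** * The strong minimum principle *)

Section StrongMinimum.
Context {R : realType} {d : nat}.
Local Notation E := 'rV[R]_d.+1.
Implicit Types (x y z p q u v : E) (U K : set E) (F P : E -> R) (a c m : R).
Implicit Types (A : E -> 'M[R]_d.+1) (b : E -> 'I_d.+1 -> R).

Lemma Ck_sub k U K F : U `<=` K -> Ck k K F -> Ck k U F.
Proof.
move=> UK; elim: k F => [|k IHk] F [cF dF]; split=> //.
- by move=> x /UK; exact: cF.
- by move=> x /UK; exact: cF.
- move=> i; have [dFi CFi] := dF i; split; last exact: IHk.
  by move=> x /UK; exact: dFi.
Qed.

Lemma CkZ k U F a : open U -> Ck k U F -> Ck k U (a \*: F).
Proof.
move=> oU; elim: k F => [|k IHk] F CF.
  by case: CF => cF _; split; [move=> x /cF; exact: continuousZl_tmp|].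
have [cF dF] := CF; split=> [x /cF|i]; first exact: continuousZl_tmp.
have [dFi CFi] := dF i; split=> [x Ux|]; first exact: derivableZ (dFi x Ux).
apply: Ck_eq_local => // x Ux; exists U, (a \*: 'D_(evec i) F).
split=> //; first exact: IHk.
by move=> y Uy _; rewrite deriveZ//; exact: dFi.
Qed.

Lemma second_order_opZ A b U F a x : open U -> Ck 2 U F -> U x ->
  second_order_op A b (a \*: F) x = a * second_order_op A b F x.
Proof.
move=> oU [_ CF] Ux; have nU : \near x, U x by exact: open_nbhs_nbhs.
have D1 z i : U z -> 'D_(evec i) (a \*: F) z = a *: 'D_(evec i) F z.
  by have [dF _] := CF i => Uz; rewrite deriveZ//; exact: dF.
have D2 i j : 'D_(evec i) ('D_(evec j) (a \*: F)) x =
    a *: 'D_(evec i) ('D_(evec j) F) x.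
  have [_ [_ /(_ i)[dFj _]]] := CF j.
  rewrite -deriveZ; last exact: dFj.
  by apply: near_eq_derive; apply: filterS nU => z Uz; rewrite D1.
rewrite /second_order_op mulrBr; congr (_ - _); last first.
  by rewrite mulr_sumr; apply: eq_bigr => i _; rewrite D1// mulrCA.
rewrite mulr_sumr; apply: eq_bigr => i _; rewrite mulr_sumr.
by apply: eq_bigr => j _; rewrite D2 mulrCA.
Qed.

(** Hopf's argument. Suppose that F exceeds its minimum m on the side of the ball
    centred at q, and equals m at the boundary point x0. For small eps > 0,
    F - eps P with P the barrier exceeds m on a small sphere around x0: where
    P >= 0 the point lies inside the ball, and such points of the sphere form a
    compact set on which F > m; where P < 0 this is clear. As F - eps P equals m
    at x0, it has an interior minimum y, and comparing operators at y gives
    eps L P <= L F = c F <= c eps P at y, contrary to the choice of P. *)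
Lemma no_touching_ball A b U F c m q x0 : open U -> Ck 2 U F ->
  (forall z, U z -> posdef (A z)) ->
  (forall i j, {for x0, continuous (fun z => A z i j)}) ->
  (forall l, {for x0, continuous (fun z => b z l)}) ->
  0 <= c -> m <= 0 ->
  (forall z, U z -> second_order_op A b F z = c * F z) ->
  (forall z, U z -> m <= F z) -> U x0 -> F x0 = m -> x0 != q ->
  ~ (\forall z \near x0, dot (z - q) (z - q) < dot (x0 - q) (x0 - q) -> m < F z).
Proof.
move=> oU CF pA cA cb c0 m0 LF Fm Ux0 Fx0 x0q strict.
set r2 := dot (x0 - q) (x0 - q) in strict.
pose a := ((x0 - q) *m A x0 *m (x0 - q)^T) ord0 ord0.
have a0 : 0 < a by have [_ ->//] := pA x0 Ux0; rewrite subr_eq0.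
(* - T is the part of the operator applied to the barrier that is free of k. *)
have [k k0 LPx0] : exists2 k, 0 < k &
    0 < second_order_op A b (barrier q x0 k) x0.
  pose T := \sum_i \sum_j 4 * (A x0 i j * dot (evec i : E) (evec j))
     - \sum_l 2 * (b x0 l * dot (x0 - q) (evec l)).
  exists ((`|T| + 1) / (8 * a)).
    by rewrite divr_gt0 ?mulr_gt0// ltr_wpDl.
  rewrite second_order_op_barrier -/T -/a.
  rewrite (_ : 8 * _ * a = `|T| + 1); last by field; rewrite gt_eqF.
  by rewrite subr_gt0 (le_lt_trans (ler_norm _))// ltrDl.
pose P := barrier q x0 k; have CP : Ck 2 setT P := @barrier_Ck2 R d q x0 k.
have cP z : {for z, continuous P} by apply: (Ck_continuous CP).
have P0 : P x0 = 0 by exact: barrier_center.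
have [e e0 He] : exists2 e : R, 0 < e & forall z, dot (z - x0) (z - x0) <= e ->
    [/\ U z, c * P z < second_order_op A b P z, 0 < 1 + k * gap q x0 z &
        (dot (z - q) (z - q) < r2 -> m < F z)].
  apply: near_dot_ball.
  have cLP : {for x0, continuous (fun z => second_order_op A b P z - c * P z)}.
    apply: (@continuousB R R^o _ _ (fun z => c * P z)).
      exact: (continuous_second_order_op CP).
    exact: (continuousM (@cst_continuous _ _ c x0) (cP x0)).
  have n1 : \forall z \near x0, 0 < second_order_op A b P z - c * P z.
    by apply: (cvgr_gt _ cLP); rewrite P0 mulr0 subr0.
  have cg : {for x0, continuous (fun z => 1 + k * gap q x0 z)}.
    apply: (@continuousD R R^o _ (fun=> 1) (fun z => k * gap q x0 z)).
      exact: cst_continuous.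
    exact: (continuousM (@cst_continuous _ _ k x0) (@continuous_gap R d q x0 x0)).
  have n2 : \forall z \near x0, 0 < 1 + k * gap q x0 z.
    by apply: (cvgr_gt _ cg); rewrite /gap subrr mulr0 addr0.
  have n3 : \near x0, U x0 by exact: open_nbhs_nbhs.
  near=> z; split.
  - by near: z.
  - by rewrite -subr_gt0; near: z.
  - by near: z.
  - by near: z.
pose N := [set z : E | dot (z - x0) (z - x0) <= e].
have cN : compact N by exact: compact_dot_ball.
have CFz z : U z -> {for z, continuous F} by apply: (Ck_continuous CF).
pose T := N `&` ([set z : E | e <= dot (z - x0) (z - x0)] `&` [set z | 0 <= P z]).
have cT : compact T.
  apply: compact_closedI => //; apply: closedI.
    apply: (@preimage_closed _ _ (fun z => dot (z - x0) (z - x0)) [set r | e <= r]).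
      by move=> z _; exact: continuous_sqn.
    exact: closed_ge.
  apply: (@preimage_closed _ _ P [set r | 0 <= r]); last exact: closed_ge.
  by move=> z _; exact: cP.
have FT z : T z -> m < F z.
  case=> [/= /He[_ _ kg Hz] [/= ez Pz]]; apply: Hz; rewrite -subr_gt0.
  have : 0 < gap q x0 z * (1 + k * gap q x0 z).
    apply: (lt_le_trans e0); apply: (le_trans ez); rewrite -subr_ge0.
    rewrite (_ : _ - _ = P z); [exact: Pz|rewrite /P /barrier; ring].
  by rewrite pmulr_lgt0.
(* eps is small against the minimum of F - m and the maximum of P on T. *)
have [eps eps0 Heps] : exists2 eps, 0 < eps & forall z, T z -> m < F z - eps * P z.
  have [T0|/set0P T0] := eqVneq T set0.
    by exists 1 => // z; rewrite T0.
  have [t0 Tt0 Ft0] : exists2 t, T t & forall z, T z -> F t <= F z.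
    by apply: attains_min => // z [/He[Uz _ _ _] _]; exact: CFz.
  have [t1 Tt1 Pt1] : exists2 t, T t & forall z, T z -> - P t <= - P z.
    by apply: attains_min => // z _; exact: continuousN.
  have P1 : 0 <= P t1 by case: Tt1 => _ [].
  have e1 : 0 < (F t0 - m) / (P t1 + 1).
    by apply: divr_gt0; [rewrite subr_gt0 FT|rewrite ltr_wpDl].
  exists ((F t0 - m) / (P t1 + 1)) => // z Tz.
  rewrite ltrBrDr -ltrBrDl.
  apply: (@le_lt_trans _ _ ((F t0 - m) / (P t1 + 1) * P t1)).
    by rewrite ler_wpM2l ?(ltW e1)// -lerN2 Pt1.
  apply: (@lt_le_trans _ _ (F t0 - m)); last by rewrite lerB// Ft0.
  by rewrite mulrAC ltr_pdivrMr ?ltr_wpDl// ltr_pM2l ?ltrDl// subr_gt0 FT.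
have [y Ny ymin] : exists2 y, N y & forall z, N z -> F y - eps * P y <= F z - eps * P z.
  apply: attains_min => //.
    by exists x0; rewrite /N/= subrr dot0 ltW.
  move=> z /He[Uz _ _ _].
  exact: (continuousB (CFz z Uz) (continuousM (@cst_continuous _ _ eps z) (cP z))).
have [Uy LPy _ _] := He y Ny.
have wy : F y - eps * P y <= m.
  rewrite -Fx0 -[leRHS]subr0 -(mulr0 eps) -P0; apply: ymin.
  by rewrite /N/= subrr dot0 ltW.
have Py : 0 <= P y.
  rewrite leNgt; apply/negP => Pyneg.
  have : F y < F y - eps * P y by rewrite ltrDl oppr_gt0 pmulr_rlt0.
  by move=> /(le_lt_trans (Fm y Uy)); rewrite ltNge wy.
have ye : dot (y - x0) (y - x0) < e.
  rewrite ltNge; apply/negP => ey.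
  by have := Heps y (conj Ny (conj ey Py)); rewrite ltNge wy.
have nN : \forall z \near y, N z.
  by apply: filterS (open_dot_ball ye) => z /ltW.
have CPU : Ck 2 U P by exact: Ck_sub CP.
have Lle : eps * second_order_op A b P y <= c * F y.
  rewrite -(second_order_opZ A b eps oU CPU Uy) -(LF y Uy).
  apply: (@second_order_op_touching R d A b U F (eps \*: P) y oU CF
    (CkZ eps oU CPU) Uy (pA y Uy)).
  by apply: filterS nN => z; exact: ymin.
suff : c * F y < eps * second_order_op A b P y by rewrite ltNge Lle.
apply: (@le_lt_trans _ _ (eps * (c * P y))); last by rewrite ltr_pM2l.
by rewrite mulrCA ler_wpM2l//; lra.
Unshelve. all: by end_near. Qed.

(** If F q > m for some q close to p, the largest ball centred at q on which
    F > m touches the level set of m at a point close to p, which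
    no_touching_ball excludes. *)
Lemma strong_minimum_principle A b U F c m p : open U -> Ck 2 U F ->
  (forall z, U z -> posdef (A z)) ->
  (forall z i j, U z -> {for z, continuous (fun z => A z i j)}) ->
  (forall z l, U z -> {for z, continuous (fun z => b z l)}) ->
  0 <= c -> m <= 0 ->
  (forall z, U z -> second_order_op A b F z = c * F z) ->
  (forall z, U z -> m <= F z) -> U p -> F p = m ->
  \forall z \near p, F z = m.
Proof.
move=> oU CF pA cA cb c0 m0 LF Fm Up Fp.
have nU : \near p, U p by exact: open_nbhs_nbhs.
have [e e0 He] := near_dot_ball nU.
have e4 : dot (p - p) (p - p) < e / 4 by rewrite subrr dot0 divr_gt0.
(* With q that close to p, the point of the level set nearest to q is at squared
   distance less than e from p, as |x0 - p|^2 <= 2 |x0 - q|^2 + 2 |q - p|^2. *)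
apply: filterS (open_dot_ball e4) => q qp; apply/eqP; apply: contraT => Fq.
pose K := [set z : E | dot (z - p) (z - p) <= e].
have CFz z : U z -> {for z, continuous F} by apply: (Ck_continuous CF).
pose Z := K `&` [set z | F z <= m].
have cZ : compact Z.
  apply: (subclosed_compact _ (@compact_dot_ball R d p e)); last by move=> z [].
  move=> z clz; have Kz : K z.
    by apply: (@closed_dot_ball R d p e) => B /clz[y [[? _] ?]]; exists y.
  split=> //=; rewrite leNgt; apply/negP => Fz.
  have /clz[y [[_ /=]]] : \forall y \near z, m < F y.
    exact: (cvgr_gt _ (CFz z (He z Kz))).
  by rewrite leNgt => /negP.
have Zp : Z p by split; [rewrite /K/= subrr dot0 ltW|rewrite /= Fp].
have [x0 [Kx0 Fx0] Hx0] : exists2 x, Z x & forall z, Z z ->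
    dot (x - q) (x - q) <= dot (z - q) (z - q).
  apply: attains_min => //; last by move=> z _; exact: continuous_sqn.
  by exists p.
have Ux0 : U x0 by exact: He.
have {}Fx0 : F x0 = m by apply/eqP; rewrite eq_le Fx0 Fm.
have pqd : dot (p - q) (p - q) < e / 4 by rewrite -dotN opprB.
have x0e : dot (x0 - p) (x0 - p) < e.
  have := dotD_le (x0 - q) (q - p); rewrite subrKA => /le_lt_trans; apply.
  have : dot (x0 - q) (x0 - q) <= dot (p - q) (p - q) by exact: Hx0.
  lra.
exfalso; apply: (@no_touching_ball A b U F c m q x0) => //.
- by move=> i j; exact: cA.
- by move=> l; exact: cb.
- by apply: contra_neq Fq => <-.
apply: filterS (open_dot_ball x0e) => z /ltW Kz zq.
rewrite ltNge; apply/negP => Fz; move: zq.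
by rewrite ltNge => /negP; apply; apply: Hx0.
Qed.

End StrongMinimum.

(** * The Laplacian in the interior of a chart *)

Section MatrixContinuity.
Context {R : realType} {T : topologicalType}.

Lemma continuous_det n (B : T -> 'M[R]_n) (x : T) :
  (forall i j, {for x, continuous (fun z => B z i j)}) ->
  {for x, continuous (fun z => \det (B z))}.
Proof.
move=> cB; apply: continuous_sum => s _.
have cp : {for x, continuous (fun z => \prod_i B z i (perm.fun_of_perm s i))}.
  by apply: continuous_prod => i _; exact: cB.
exact: (continuousM (@cst_continuous _ _ _ x) cp).
Qed.

(** By the cofactor formula, valid near x. *)
Lemma continuous_invmx n (B : T -> 'M[R]_n) (x : T) :
  (forall i j, {for x, continuous (fun z => B z i j)}) ->
  (\near x, B x \in unitmx) ->
  forall i j, {for x, continuous (fun z => invmx (B z) i j)}.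
Proof.
move=> cB uB i j.
have e : \forall z \near x,
    (\det (B z))^-1 * ((-1) ^+ (j + i) * \det (row' j (col' i (B z))))
    = invmx (B z) i j.
  by apply: filterS uB => z uz; rewrite /invmx uz !mxE.
change ((fun z => invmx (B z) i j) @ x --> invmx (B x) i j).
rewrite -(nbhs_singleton e); apply: cvg_trans (near_eq_cvg e) _.
apply: (@cvgM R T (nbhs x) _ (fun z => (\det (B z))^-1)
  (fun z => (-1) ^+ (j + i) * \det (row' j (col' i (B z))))).
  apply: cvgV; last exact: continuous_det.
  by have := nbhs_singleton uB; rewrite unitmxE unitfE.
apply: (@cvgM R T (nbhs x) _ (fun=> (-1) ^+ (j + i))
  (fun z => \det (row' j (col' i (B z))))); first exact: cvg_cst.
apply: (@continuous_det _ (fun z => row' j (col' i (B z)))) => k l.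
rewrite (_ : (fun z => _) = (fun z => B z (lift j k) (lift i l))); first exact: cB.
by apply/funext => z; rewrite !mxE.
Qed.

End MatrixContinuity.

Section InteriorCalculus.
Context {R : realType} {d : nat}.
Local Notation E := 'rV[R]_d.+1.
Implicit Types (x y z : E) (U K : set E) (f F : E -> R).

Lemma smooth_on_Ck k K U f : smooth_on K f -> open U -> U `<=` K -> Ck k U f.
Proof.
move=> sf oU UK; apply: Ck_eq_local => // x Ux.
have [W [F [oW Wx CF fF]]] := sf x (UK x Ux).
by exists W, F; split=> // y Wy /UK; exact: fF.
Qed.

(** Away from the boundary of the half-space the one-sided restriction on the
    increments is void. *)
Lemma partialE U f F i x : open U -> U `<=` half_space -> U x ->
  (forall z, U z -> f z = F z) -> partial i f x = 'D_(evec i) F x.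
Proof.
move=> oU Uh Ux fF.
have nU : \forall h \near 0^', U (x + h *: evec i).
  have [e e0 He] := @near_line R E U x (evec i) (open_nbhs_nbhs (conj oU Ux)).
  by near=> h; apply: He; near: h; exact: dnbhs0_lt.
rewrite /partial; have -> : within [set h : R | half_space (x + h *: evec i)] 0^' = 0^'.
  apply/seteqP; split=> Q; rewrite /within/=; last by apply: filterS.
  by apply: filterS2 nU => h /Uh hx; apply.
have eq_q : \forall h \near 0^', h^-1 *: ((F \o shift x) (h *: evec i) - F x) =
    h^-1 * (f (x + h *: evec i) - f x).
  by apply: filterS nU => h Uh'; rewrite !fF// [x + _]addrC.
congr (lim _); apply/seteqP; split; apply: near_eq_cvg => //.
by apply: filterS eq_q => h /esym.
Unshelve. all: by end_near. Qed.

Section Metric.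
Variables (g : E -> 'M[R]_d.+1) (U : set E).
Hypotheses (oU : open U) (Uh : U `<=` half_space).
Hypothesis g_smooth : forall i j, Ck 1 U (fun z => g z i j).
Hypothesis g_posdef : forall z, U z -> posdef (g z).

Lemma ginv_posdef z : U z -> posdef (ginv g z).
Proof. by move=> /g_posdef/posdef_inv. Qed.

Lemma continuous_ginv z i j : U z -> {for z, continuous (fun z => ginv g z i j)}.
Proof.
move=> Uz; apply: continuous_invmx => [k l|].
  exact: (Ck_continuous (g_smooth k l)).
have : \near z, U z by exact: open_nbhs_nbhs.
by apply: filterS => y /g_posdef/posdef_unit.
Qed.

Lemma continuous_christoffel z k i j : U z ->
  {for z, continuous (christoffel g k i j)}.
Proof.
move=> Uz; have nU : \near z, U z by exact: open_nbhs_nbhs.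
pose dg a b c (y : E) := 'D_(evec a) (fun y => g y b c) y.
have cdg a b c : {for z, continuous (dg a b c)}.
  by have [_ /(_ a)[_ [+ _]]] := g_smooth b c; apply.
have e : \forall y \near z,
    2^-1 * (\sum_l ginv g y k l * (dg i j l y + dg j i l y - dg l i j y))
    = christoffel g k i j y.
  apply: filterS nU => y Uy; rewrite /christoffel; congr (_ * _).
  by apply: eq_bigr => l _; rewrite !(partialE _ oU Uh Uy (fun _ _ => erefl _)).
change (christoffel g k i j @ z --> christoffel g k i j z).
rewrite -(nbhs_singleton e); apply: cvg_trans (near_eq_cvg e) _.
apply: (@cvgM R E (nbhs z) _ (fun=> 2^-1)
  (fun y => \sum_l ginv g y k l * (dg i j l y + dg j i l y - dg l i j y))).
  exact: cvg_cst.
apply: continuous_sum => l _.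
exact: (continuousM (continuous_ginv Uz)
  (continuousB (continuousD (cdg i j l) (cdg j i l)) (cdg l i j))).
Qed.

(** The coefficients of the first-order part of the Laplacian, up to sign. *)
Definition laplacian_drift z (k : 'I_d.+1) : R :=
  \sum_i \sum_j ginv g z i j * christoffel g k i j z.

Lemma continuous_laplacian_drift z k : U z ->
  {for z, continuous (fun y => laplacian_drift y k)}.
Proof.
move=> Uz; apply: continuous_sum => i _; apply: continuous_sum => j _.
exact: (continuousM (continuous_ginv Uz) (continuous_christoffel Uz)).
Qed.

Lemma laplacianE f z : U z ->
  laplacian g f z = second_order_op (ginv g) laplacian_drift f z.
Proof.
move=> Uz; have pE i y : U y -> partial i f y = 'D_(evec i) f y.
  by move=> Uy; exact: (partialE _ oU Uh Uy).
have ppE i j : partial i (partial j f) z = 'D_(evec i) ('D_(evec j) f) z.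
  exact: (partialE _ oU Uh Uz (pE j)).
rewrite /laplacian /trace_g /second_order_op.
have -> : \sum_k laplacian_drift z k * 'D_(evec k) f z =
    \sum_i \sum_j ginv g z i j * \sum_k christoffel g k i j z * partial k f z.
  under eq_bigr => k _ do rewrite mulr_suml.
  rewrite exchange_big; apply: eq_bigr => i _ /=.
  under eq_bigr => k _ do rewrite mulr_suml.
  rewrite exchange_big; apply: eq_bigr => j _ /=.
  by rewrite mulr_sumr; apply: eq_bigr => k _; rewrite pE// mulrA.
rewrite -sumrB; apply: eq_bigr => i _; rewrite -sumrB; apply: eq_bigr => j _.
by rewrite mxE ppE mulrBr.
Qed.

Lemma trace_metric z : U z -> trace_g g z (g z) = d.+1%:R.
Proof.
move=> Uz; have [symg _] := g_posdef Uz.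
rewrite -(mxtrace1 R d.+1) -(mulVmx (posdef_unit (g_posdef Uz))).
apply: eq_bigr => i _; rewrite mxE; apply: eq_bigr => j _.
by have -> : g z i j = g z j i by rewrite -{1}symg mxE.
Qed.

Lemma trace_gB z S T : trace_g g z (S - T) = trace_g g z S - trace_g g z T.
Proof.
rewrite -sumrB; apply: eq_bigr => i _; rewrite -sumrB; apply: eq_bigr => j _.
by rewrite !mxE mulrBr.
Qed.

Lemma trace_gZ z a T : trace_g g z (a *: T) = a * trace_g g z T.
Proof.
rewrite mulr_sumr; apply: eq_bigr => i _; rewrite mulr_sumr.
by apply: eq_bigr => j _; rewrite mxE mulrCA.
Qed.

(** The trace of the static equation is lap f - (d + 1) lap f - f R = 0 with
    R = d Lambda, and d is not 0. *)
Lemma trace_static_equation f z Lambda : (2 <= d.+1)%N -> U z ->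
  hess g f z - laplacian g f z *: g z - f z *: ricci g z = 0 ->
  Defs.scalar g z = (d.+1%:R - 1) * Lambda ->
  laplacian g f z = - Lambda * f z.
Proof.
move=> d2 Uz static Rg; have := congr1 (trace_g g z) static.
rewrite !trace_gB !trace_gZ trace_metric// -/(Defs.scalar g z) -/(laplacian g f z) Rg.
rewrite -(scale0r 0) trace_gZ mul0r => eq0.
have d0 : d.+1%:R - 1 != 0 :> R by rewrite -natr1 addrK pnatr_eq0 -lt0n.
apply: (mulfI d0); apply/eqP; rewrite -subr_eq0 -oppr_eq0 -eq0; apply/eqP; ring.
Qed.

End Metric.
End InteriorCalculus.

(** * Static manifolds *)

Section Manifold.
Context {R : realType} {d : nat} {M : manifold R d}.
Implicit Types (c : chart R d M) (p q : M) (V : M -> R) (g : metric M).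

Lemma chart_map_continuous c p : chart_dom c p ->
  {for p, continuous (chart_map c)}.
Proof.
move=> cp; have := chart_map_cont (c := c).
rewrite continuous_open_subspace; last exact: chart_dom_open.
by apply; rewrite inE.
Qed.

Lemma near_chart_dom c p : chart_dom c p -> \forall q \near p, chart_dom c q.
Proof. by move=> cp; apply: open_nbhs_nbhs; split=> //; exact: chart_dom_open. Qed.

Lemma smooth_continuous V : smooth V -> continuous V.
Proof.
move=> sV p; have [c Ac cp] := (manifold_atlas M).1 p.
have ip : chart_img c (chart_map c p) by exists p.
have [U [F [oU Ux CF VF]]] := sV c Ac _ ip.
have cm := chart_map_continuous cp.
have e : \forall q \near p, (F \o chart_map c) q = V q.
  have nU : \forall q \near p, U (chart_map c q).
    by apply: cm; exact: open_nbhs_nbhs.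
  apply: filterS2 nU (near_chart_dom cp) => q Uq cq /=.
  by rewrite -VF//= ?chart_mapK//; exists q.
change (V @ p --> V p); rewrite -(nbhs_singleton e).
apply: cvg_trans (near_eq_cvg e) _.
by apply: continuous_comp => //; have [cF _] := CF 0%N; exact: cF.
Qed.

(** A point outside the boundary has positive first coordinate in every chart
    of the atlas, so that an open set of the whole space fits in the image. *)
Lemma interior_chart p : ~ boundary M p -> exists c U, [/\ atlas c,
  chart_dom c p, open U, U (chart_map c p) & U `<=` chart_img c `&` half_space].
Proof.
move=> pM; have [c Ac cp] := (manifold_atlas M).1 p.
have [W oW Wimg] := chart_img_open c.
have : (chart_map c @` chart_dom c) (chart_map c p) by exists p.
rewrite Wimg => -[Wp hp].
exists c, (W `&` [set x | 0 < x ord0 ord0]); split=> //.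
- apply: openI => //; apply: (@open_comp _ _ (fun x : 'rV[R]_d.+1 => x ord0 ord0)
    [set r | 0 < r]).
    by move=> x _; exact: coord_continuous.
  exact: open_gt.
- split=> //=; rewrite lt_neqAle hp andbT eq_sym.
  by apply/eqP => h; apply: pM; exists c.
- move=> x [Wx /= x0]; have hx : half_space x by exact: ltW.
  by split=> //; rewrite /chart_img Wimg.
Qed.

(** In a chart, s V solves lap u = - Lambda u with - Lambda >= 0, to which the
    strong minimum principle applies at p. The factor s allows V to be replaced
    by its opposite. *)
Lemma static_level_set_open g V (Lambda s m : R) p : (2 <= d.+1)%N ->
  static_manifold g V -> cosmological_constant g Lambda -> Lambda <= 0 ->
  (forall q, m <= s * V q) -> m <= 0 -> s * V p = m -> ~ boundary M p ->
  \forall q \near p, s * V q = m.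
Proof.
move=> d2 [sV _ static _] Rg L0 Vm m0 Vp pM.
have [c [U [Ac cp oU Up Usub]]] := interior_chart pM.
have Uimg x : U x -> chart_img c x by move=> /Usub[].
have Uh : U `<=` half_space by move=> x /Usub[].
pose f := V \o chart_inv c.
have g1 i j : Ck 1 U (fun x => g c x i j).
  exact: (smooth_on_Ck _ (metric_smooth g Ac i j) oU Uimg).
have gpos x : U x -> posdef (g c x).
  move=> /Uimg ix; split; first exact: Defs.metric_sym.
  by move=> v; exact: Defs.metric_pos.
have f2 : Ck 2 U f by exact: (smooth_on_Ck _ (sV c Ac) oU Uimg).
have fV q : chart_dom c q -> f (chart_map c q) = V q.
  by move=> cq; rewrite /f/= chart_mapK.
have Lf x : U x -> second_order_op (ginv (g c)) (laplacian_drift (g c))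
    (s \*: f) x = - Lambda * (s \*: f) x.
  move=> Ux; rewrite (second_order_opZ _ _ s oU f2 Ux) -(laplacianE (g c) oU Uh f Ux).
  rewrite (trace_static_equation gpos d2 Ux (static c x Ac (Uimg x Ux))
    (Rg c x Ac (Uimg x Ux))).
  exact: mulrCA.
have nx : \forall x \near chart_map c p, (s \*: f) x = m.
  apply: (strong_minimum_principle oU (CkZ s oU f2) _ _ _ _ m0 Lf _ Up).
  - by move=> x; exact: (ginv_posdef gpos).
  - by move=> x i j; exact: (continuous_ginv oU g1 gpos).
  - by move=> x k; exact: (continuous_laplacian_drift oU Uh g1 gpos).
  - by rewrite oppr_ge0.
  - by move=> x /Uimg[q cq <-]; rewrite /= fV//; exact: Vm.
  - by rewrite /= fV.
have nq : \forall q \near p, (s \*: f) (chart_map c q) = m.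
  exact: (chart_map_continuous cp nx).
apply: filterS2 nq (near_chart_dom cp) => q /= <- cq.
by rewrite -/(f (chart_map c q)) fV.
Qed.

End Manifold.

Lemma components1_connected (T : topologicalType) (A C : set T) :
  components A = [set C] -> connected A /\ A !=set0.
Proof.
move=> compA; have [x Ax xC] : components A C by rewrite compA.
suff -> : A = C by split; [rewrite -xC; exact: component_connected|
  exists x; rewrite -xC; exact: connected_component_refl].
apply/seteqP; split=> y.
- move=> Ay; have : components A (connected_component A y) by exists y.
  by rewrite compA => /= <-; exact: connected_component_refl.
- by rewrite -xC; exact: connected_component_sub.
Qed.

Lemma connected_constant_sign (R : realType) (T : topologicalType) (A : set T)
    (f : T -> R) x : continuous f -> connected A -> A x -> 0 < f x ->
  (forall y, A y -> f y != 0) -> forall y, A y -> 0 < f y.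
Proof.
move=> cf cA Ax fx f0 y Ay; rewrite lt_neqAle eq_sym f0//= leNgt.
apply/negP => /ltW fy.
have : connected (f @` A).
  by apply: connected_continuous_connected => //; exact: continuous_subspaceT.
move=> /connected_intervalP fA; have [z Az fz] : (f @` A) 0.
  by apply: (fA (f y) (f x)); [exists y|exists x|rewrite fy ltW].
by have := f0 z Az; rewrite fz eqxx.
Qed.

(* The dimension of M is d.+1. *)
Theorem theorem1p5 (R : realType) (d : nat) (hd : (2 <= d.+1)%N)
    (M : manifold R d) (g : metric M) (V : M -> R) (Lambda : R)
    (M_orientable : orientable M)
    (M_connected : connected [set: M])
    (M_compact : compact [set: M])
    (M_static : static_manifold g V)
    (Lambda_def : cosmological_constant g Lambda)
    (Lambda_le0 : Lambda <= 0)
    (one_component : exists C : set M, components (boundary M) = [set C]) :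
  ((V @^-1` [set 0]) `&` boundary M !=set0) \/ (forall p : M, V p != 0).
Proof.
have [?|noz] := pselect ((V @^-1` [set 0]) `&` boundary M !=set0); first by left.
right; have [C /components1_connected[bM_conn [b bb]]] := one_component.
have Vb q : boundary M q -> V q != 0.
  by move=> bq; apply/eqP => Vq; apply: noz; exists q.
have cV : continuous V by case: M_static => + _ _ _; exact: smooth_continuous.
(* Multiplying V by its value at a boundary point makes it positive there. *)
pose s := V b; pose W q := s * V q.
have cW : continuous W.
  by move=> q; exact: (continuousM (@cst_continuous _ _ _ q) (cV q)).
have Wb q : boundary M q -> 0 < W q.
  move=> bq; apply: (connected_constant_sign cW bM_conn bb) => //.
    by rewrite /W /s -expr2 exprn_even_gt0//= Vb.
  by move=> y yb; apply: mulf_neq0; exact: Vb.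
have [p _ pmin] : exists2 p, [set: M] p & forall q, [set: M] q -> W p <= W q.
  have [||p _ Hp] := @compact_EVT_min M R W [set: M] _ M_compact.
  - by exists b.
  - exact: continuous_subspaceT.
  - by exists p => // q _; apply: Hp; rewrite inE.
have [Wp q|Wp] := ltP 0 (W p).
  have := lt_le_trans Wp (pmin q I); rewrite /W.
  by apply: contraTneq => ->; rewrite mulr0 ltxx.
have levelM : [set q | W q = W p] = [set: M].
  apply: M_connected.
  - by exists p.
  - exists [set q | W q = W p]; last by rewrite setTI.
    rewrite openE => q Wq.
    have bq : ~ boundary M q by move=> /Wb; rewrite Wq ltNge Wp.
    apply: (static_level_set_open hd M_static Lambda_def Lambda_le0 _ Wp Wq bq).
    by move=> y; exact: pmin.
  - exists [set q | W q = W p]; last by rewrite setTI.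
    apply: (@preimage_closed _ _ W [set r | r = W p]); last exact: closed_eq.
    by move=> q _; exact: cW.
have : [set q | W q = W p] b by rewrite levelM.
by move=> Wbp; have := Wb b bb; rewrite Wbp ltNge Wp.
Qed.
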